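(* Every infinite, connected, locally finite chordal graph $G$ has a clique tree, i.e. there is a spanning tree $T$ of the clique graph $\mathcal{C}(G)$ such that for every vertex $v$ of $G$ the induced subgraph $T[\{K\in\mathcal{K}(G): v\in K\}]$ is a tree.
   Context: A chordal graph is a loopless graph without multiple edges containing no induced cycle of length greater than $3$; in this paper chordal graphs are assumed connected. Locally finite means every vertex has finite degree. A clique is a maximal complete vertex set; $\mathcal{K}(G)$ is the set of cliques. The clique graph $\mathcal{C}(G)$ has vertex set $\mathcal{K}(G)$ and an edge between two distinct cliques whenever they intersect. For a subgraph $T$ and a set $F$ of its vertices, $T[F]$ is the induced subgraph. *)

(* Defs.v *)
From Stdlib Require Import Relation_Operators.
From mathcomp Require Import all_boot.
From mathcomp Require Import mathcomp_extra boolp classical_sets functions cardinality.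

Set Implicit Arguments.
Unset Strict Implicit.
Unset Printing Implicit Defensive.

Local Open Scope classical_set_scope.

(* Simple graphs, possibly infinite, with vertex set the whole type [V]. *)
Record graph (V : Type) := Graph {
  adj : V -> V -> Prop;
  adj_sym : forall x y, adj x y -> adj y x;
  adj_irrefl : forall x, ~ adj x x }.

Section Graphs.
Variables (V : Type) (G : graph V).

Definition locally_finite := forall v, finite_set [set w | adj G v w].

(* The null graph is not connected, so trees are nonempty. *)
Definition connected :=
  [set: V] !=set0 /\ forall x y, clos_refl_trans V (adj G) x y.

(* [c] lists the vertices of a cycle of length [n] in cyclic order; [ordS] is
   the successor modulo [n]. *)
Definition is_cycle n (c : 'I_n -> V) :=
  [/\ (3 <= n)%N, injective c & forall i, adj G (c i) (c (ordS i))].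

Definition is_induced_cycle n (c : 'I_n -> V) :=
  is_cycle c /\
  forall i j, adj G (c i) (c j) -> j = ordS i \/ i = ordS j.

Definition chordal :=
  forall n (c : 'I_n -> V), (3 < n)%N -> ~ is_induced_cycle c.

Definition acyclic := forall n (c : 'I_n -> V), ~ is_cycle c.

Definition is_tree := connected /\ acyclic.

Definition complete_set (A : set V) :=
  forall x y, A x -> A y -> x <> y -> adj G x y.

Definition is_clique (A : set V) :=
  complete_set A /\ forall B, complete_set B -> A `<=` B -> B = A.

Definition cliques : set (set V) := [set A | is_clique A].

Definition induced_adj (F : set V) (x y : F) := adj G (val x) (val y).

Lemma induced_adj_sym (F : set V) (x y : F) : induced_adj x y -> induced_adj y x.
Proof. exact: adj_sym. Qed.

Lemma induced_adj_irrefl (F : set V) (x : F) : ~ induced_adj x x.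
Proof. exact: adj_irrefl. Qed.

Definition induced (F : set V) : graph F :=
  Graph (@induced_adj_sym F) (@induced_adj_irrefl F).

Definition clique_adj (K L : cliques) := K <> L /\ val K `&` val L !=set0.

Lemma clique_adj_sym K L : clique_adj K L -> clique_adj L K.
Proof. by move=> [KL KL0]; split; [exact: nesym | rewrite setIC]. Qed.

Lemma clique_adj_irrefl K : ~ clique_adj K K.
Proof. by case. Qed.

Definition clique_graph : graph cliques :=
  Graph clique_adj_sym clique_adj_irrefl.

End Graphs.

(* [T] has the same vertex type as [G], hence spans it. *)
Definition spanning_tree (V : Type) (G T : graph V) :=
  (forall x y, adj T x y -> adj G x y) /\ is_tree T.

Definition clique_tree (V : Type) (G : graph V) (T : graph (cliques G)) :=
  spanning_tree (clique_graph G) T /\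
  forall v : V, is_tree (induced T [set K : cliques G | val K v]).

(* Main.v *)
Require Import Defs.
From mathcomp Require Import all_boot.
From mathcomp Require Import mathcomp_extra boolp classical_sets functions cardinality.
From Stdlib Require Import Relation_Operators Operators_Properties.
From mathcomp Require Import zify.

Local Open Scope classical_set_scope.

(** For every nonempty complete set [C], take the cliques containing [C], call two
    of them equivalent if they meet the same component of [G - C], and join one
    root clique by a star to one representative of every other class. The union
    of these stars, over all [C], is a clique tree.

    Local finiteness allows an induction on growing [C] showing that the cliques
    over [C] are linked by tree edges among themselves: inequivalent classes are
    joined by the star of [C], while in a chordal graph two equivalent cliques are
    joined by a path inside the common neighbourhood of [C], hence by a chain of
    cliques whose consecutive intersections strictly contain [C]. No cycle exists,
    because the component of a leaf in the star of a minimal intersection [C] on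
    the cycle can be left through one edge only. *)

(** * Induction, choice and cyclic successors *)

(** Induction on the number of elements of [D] missing from [C]; [C] itself may be infinite. *)
Lemma finite_superset_ind (T : Type) (D : set T) (P : set T -> Prop) :
  finite_set D ->
  (forall C, (forall x, D x -> ~ C x -> P (x |` C)) -> P C) ->
  forall C, P C.
Proof.
elim/Peq: T => T in D P *.
move=> /finite_seqP[s Ds] IH C.
have [n] := ubnP (count (fun x => `[< ~ C x >]) s).
elim: n C => // n IHn C; rewrite ltnS => leCn.
apply: IH => x; rewrite Ds /= => xs nCx; apply: IHn.
apply: leq_trans leCn; elim: s xs {Ds} => // y s IHs.
have le_ys z : (`[< ~ (x |` C) z >] <= `[< ~ C z >])%N.
  case: asboolP => // h; rewrite asboolT // => Cz.
  by case: h; right.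
rewrite inE => /orP[/eqP <-|/IHs lt_s] /=; last first.
  by rewrite -addnS; apply: leq_add; [exact: le_ys | exact: lt_s].
rewrite (asboolT nCx) asboolF ?ltnS; last by apply; left.
by apply: sub_count => z /asboolP h; apply/asboolP => Cz; apply: h; right.
Qed.

(** A single choice function for all sets makes equal classes receive equal representatives. *)
Lemma exists_choice (T : Type) :
  [set: T] !=set0 -> exists pick : set T -> T, forall A, A !=set0 -> A (pick A).
Proof.
case=> t0 _; have /choice[pick pickP] : forall A : set T, exists t, A !=set0 -> A t.
  move=> A; case: (pselect (A !=set0)) => [[t At]|nA]; first by exists t.
  by exists t0.
by exists pick.
Qed.

Lemma iter_ordS n (i : 'I_n) k : val (iter k (@ordS n) i) = ((i + k) %% n)%N.
Proof.
elim: k => [|k IHk] /=; first by rewrite addn0 modn_small.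
by rewrite IHk addnS -addn1 modnDml addn1.
Qed.

Lemma iter_ordS_neq n (i : 'I_n) k : (0 < k < n)%N -> iter k (@ordS n) i <> i.
Proof.
move=> /andP[k0 kn] /(congr1 val); rewrite iter_ordS => h.
have : (i + k == i + 0 %[mod n])%N by rewrite h addn0 modn_small.
by rewrite eqn_modDl mod0n modn_small // -leqn0 leqNgt k0.
Qed.

(* A property that changes across at most one edge of a cycle changes across none. *)
Lemma cyclic_exit n (P : 'I_n -> Prop) (i : 'I_n) :
  (forall j, j <> i -> P j <-> P (ordS j)) -> P i <-> P (ordS i).
Proof.
move=> step.
have around k : (k < n)%N -> P (ordS i) <-> P (iter k (@ordS n) (ordS i)).
  elim: k => // k IHk kn; rewrite (IHk (ltnW kn)) iterS; apply: step.
  by rewrite -iterSr; exact: iter_ordS_neq.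
have n0 : (0 < n)%N := leq_ltn_trans (leq0n i) (ltn_ord i).
rewrite (around n.-1) ?prednK // -iterSr prednK //.
suff -> : iter n (@ordS n) i = i by [].
by apply: val_inj; rewrite /= iter_ordS modnDr modn_small.
Qed.

(** * Walks, geodesics and chordality *)

Section Linked.
Variables (V : Type) (G : graph V).
Implicit Types (F C : set V) (x y z : V).

(** Reflexivity gives [linked F x x] even outside [F]; extracting a walk inside [F] therefore needs
    [F x]. *)
Definition linked F := clos_refl_trans V (fun x y => [/\ adj G x y, F x & F y]).

Lemma linked_trans F x y z : linked F x y -> linked F y z -> linked F x z.
Proof. exact: rt_trans. Qed.

Lemma linked_sym F x y : linked F x y -> linked F y x.
Proof.
elim=> {x y} [x y [Axy Fx Fy]|x|x y z _ yx _ zy]; last exact: linked_trans zy yx.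
- by apply: rt_step; split=> //; exact: adj_sym.
- exact: rt_refl.
Qed.

Lemma linked_sub F F' x y : F `<=` F' -> linked F x y -> linked F' x y.
Proof.
move=> FF'; elim=> {x y} [x y [Axy /FF' Fx /FF' Fy]|x|x y z _ xy _ yz].
- exact: rt_step.
- exact: rt_refl.
- exact: linked_trans xy yz.
Qed.

Lemma linked_induced F (x y : F) :
  linked F (val x) (val y) -> clos_refl_trans F (adj (induced G F)) x y.
Proof.
case: x y => x Fx [y Fy] /= h; have {h} xy := clos_rt_rt1n _ _ _ _ h.
elim: xy Fx Fy => {x y} [x|x y z [Axy _ Fy] _ IH] Fx Fz.
  by rewrite (Prop_irrelevance Fx Fz); exact: rt_refl.
by apply: rt_trans (IH (mem_set Fy) Fz); exact: rt_step.
Qed.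

(* [p 0], ..., [p m] is a walk inside [F]; the values beyond [m] are junk. *)
Definition walk F m (p : nat -> V) :=
  (forall i, (i < m)%N -> adj G (p i) (p i.+1)) /\ (forall i, (i <= m)%N -> F (p i)).

Lemma linked_walk F x y : F x -> linked F x y ->
  exists m p, [/\ walk F m p, p 0 = x & p m = y].
Proof.
move=> Fx h; have {h} xy := clos_rt_rt1n _ _ _ _ h; elim: xy Fx => {x y} [x|x y z [Axy _ Fy] _ IH] Fx.
  by exists 0, (fun=> x); split=> //; split.
have [m [p [[Ap Fp] p0 pm]]] := IH Fy.
exists m.+1, (fun i => if i is i'.+1 then p i' else x); split=> //; split.
- by case=> [_|i]; [rewrite p0 | exact: Ap].
- by case=> // i; exact: Fp.
Qed.

Lemma walk_linked F m p : walk F m p ->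
  forall i, (i <= m)%N -> linked F (p 0) (p i).
Proof.
move=> [Ap Fp]; elim=> [_|i IHi im]; first exact: rt_refl.
apply: linked_trans (IHi (ltnW im)) _.
by apply: rt_step; split; [exact: Ap | apply: Fp; exact: ltnW | exact: Fp].
Qed.

(* A shortest walk has no repetition and no chord. *)
Lemma linked_geodesic F x y : F x -> linked F x y ->
  exists m p, [/\ walk F m p, p 0 = x, p m = y &
    forall i j, (i < j <= m)%N ->
      p i <> p j /\ (adj G (p i) (p j) -> j = i.+1)].
Proof.
move=> Fx /(linked_walk F x y Fx) ex_walk.
pose Q m := `[< exists p, [/\ walk F m p, p 0 = x & p m = y] >].
have : exists m, Q m by case: ex_walk => m wm; exists m; apply/asboolP.
case/ex_minnP=> m /asboolP[p [[Ap Fp] p0 pm]] min_m; exists m, p.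
split=> // i j /andP[ij jm].
(* Jumping from [p k] to [p l] would shorten the walk by [d]. *)
have chord k l : (k.+1 < l <= m)%N -> ~ adj G (p k) (p l).
  move=> /andP[kl lm] Akl; set d := (l - k.+1)%N.
  have : Q (m - d)%N; last by move/min_m; rewrite /d; lia.
  apply/asboolP; exists (fun t => if (t <= k)%N then p t else p (t + d)%N); split.
  - split=> t tm.
      have [tk|tk|->] := ltngtP t k.
      + by apply: Ap; lia.
      + by rewrite /= addSn; apply: Ap; rewrite /d in tm *; lia.
      + by have -> : (k.+1 + d)%N = l; [rewrite /d; lia |]; rewrite ?leqnn ?ltnn.
    by case: leqP => tk; apply: Fp; rewrite /d in tm *; lia.
  - by [].
  - have -> : (m - d <= k)%N = false by rewrite /d; lia.
    by rewrite subnK // /d; lia.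
split.
  (* A repetition yields a chord from [p i] to [p j.+1], or, if [j = m], a shorter walk already
     ending at [y]. *)
  move=> pij; have [jm'|jm'] := ltnP j m.
    by apply: (chord i j.+1); [lia | rewrite pij; exact: Ap].
  have : Q i; last by move/min_m; lia.
  apply/asboolP; exists p; split=> //; last by rewrite pij -pm; congr p; lia.
  by split=> t ti; [apply: Ap; lia | apply: Fp; lia].
move=> Aij; apply/eqP; case: (ltngtP j i.+1) => // ji; first by lia.
by case: (chord i j) => //; lia.
Qed.

Hypothesis chordalG : chordal G.

(* A shortest walk avoiding [C] whose ends are adjacent to [c \in C] stays in the
   neighbourhood of [c]: a maximal excursion out of it would close up, through
   [c], to an induced cycle of length at least 4. *)
Lemma chordal_linked C x y :
  (forall c, C c -> adj G c x) -> (forall c, C c -> adj G c y) ->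
  linked (~` C) x y -> linked [set z | forall c, C c -> adj G c z] x y.
Proof.
move=> Cx Cy xy.
have nCx : (~` C) x by move=> /Cx; exact: adj_irrefl.
have [m [p [[Ap nCp] p0 pm geo]]] := linked_geodesic _ _ _ nCx xy.
suff Np i : (i <= m)%N -> forall c, C c -> adj G c (p i).
  by rewrite -p0 -pm; apply: (@walk_linked _ m p).
move=> im c Cc; apply: contrapT => nAi.
pose N j := `[< adj G c (p j) >].
have exa : exists a, N a && (a < i)%N.
  exists 0; apply/andP; split; first by apply/asboolP; rewrite p0; exact: Cx.
  by rewrite lt0n; apply/eqP => i0; apply: nAi; rewrite i0 p0; exact: Cx.
have [] := ex_maxnP exa (m := i) _; first by move=> j /andP[_ /ltnW].
move=> a /andP[/asboolP Na ai] max_a.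
have exb : exists b, N b && (i < b <= m)%N.
  exists m; rewrite leqnn andbT; apply/andP; split; first by apply/asboolP; rewrite pm; exact: Cy.
  by rewrite ltn_neqAle im andbT; apply/eqP => i0; apply: nAi; rewrite i0 pm; exact: Cy.
have [b /andP[/asboolP Nb /andP[ib bm]] min_b] := ex_minnP exb.
have gap k : (a < k < b)%N -> ~ adj G c (p k).
  move=> akb Ak; have [ki|ik|ki] := ltngtP k i.
  - by have /= := max_a k; rewrite /N asboolT // ki /= => /(_ isT); lia.
  - have /= := min_b k; rewrite /N asboolT // ik /= => H.
    by have := H ltac:(lia); lia.
  - by apply: nAi; rewrite -ki.
have cp k : (k <= m)%N -> p k <> c by move=> /nCp nCpk pkc; apply: nCpk; rewrite pkc.
(* The cycle runs through [p a], ..., [p b] and closes with [c] at index [b - a + 1]; [a < i < b]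
   makes its length at least 4. *)
pose n := (b - a).+2.
have ltn_n (k : 'I_n) : (k < (b - a).+2)%N := ltn_ord k.
pose cyc (k : 'I_n) := if (k <= b - a)%N then p (a + k)%N else c.
have ordSE (k : 'I_n) : val (ordS k) = (if k <= b - a then k.+1 else 0)%N.
  rewrite /=; case: leqP => kb; first by rewrite modn_small // /n; lia.
  by have -> : nat_of_ord k = (b - a).+1; [have := ltn_n k; lia | rewrite modnn].
have n4 : (3 < n)%N by rewrite /n; lia.
apply: (chordalG n cyc n4); split; first split.
- exact: ltnW.
- move=> k l; rewrite /cyc; case: leqP => kb; case: leqP => lb.
  + move=> pkl; apply: val_inj => /=; have [kl|kl|//] := ltngtP k l.
    * by case: (geo (a + k)%N (a + l)%N ltac:(lia)).
    * by case: (geo (a + l)%N (a + k)%N ltac:(lia)) => /nesym.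
  + by move/cp; case; lia.
  + by move/esym/cp; case; lia.
  + by move=> _; apply: val_inj => /=; have := ltn_n k; have := ltn_n l; lia.
- move=> k; rewrite /cyc ordSE; case: (leqP k (b - a)%N) => kb; last by rewrite leq0n addn0; exact: Na.
  case: (leqP k.+1 (b - a)%N) => kb'; first by rewrite addnS; apply: Ap; lia.
  by apply: adj_sym; have -> : (a + k)%N = b by lia.
move=> k l; rewrite /cyc; case: leqP => kb; case: leqP => lb Akl.
- have [kl|kl|kl] := ltngtP k l.
  + left; apply: val_inj; rewrite ordSE kb.
    by case: (geo (a + k)%N (a + l)%N ltac:(lia)) => _ /(_ Akl) /=; lia.
  + right; apply: val_inj; rewrite ordSE lb.
    by case: (geo (a + l)%N (a + k)%N ltac:(lia)) => _ /(_ (adj_sym Akl)) /=; lia.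
  + by exfalso; rewrite kl in Akl; exact: adj_irrefl Akl.
- have [k0|k0] := posnP k.
    by right; apply: val_inj; rewrite ordSE leqNgt lb /= k0.
  have [kb'|kb'] := ltnP k (b - a)%N.
    by case: (gap (a + k)%N); [lia | exact: adj_sym].
  by left; apply: val_inj; rewrite ordSE kb /=; have := ltn_n l; lia.
- have [k0|k0] := posnP l.
    by left; apply: val_inj; rewrite ordSE leqNgt kb /= k0.
  have [kb'|kb'] := ltnP l (b - a)%N.
    by case: (gap (a + l)%N); [lia | ].
  by right; apply: val_inj; rewrite ordSE lb /=; have := ltn_n k; lia.
- by exfalso; exact: adj_irrefl Akl.
Qed.

End Linked.

Arguments linked {V}.

Lemma linked_connected (V : Type) (G : graph V) (F : set V) (x y : V) :
  linked G F x y -> clos_refl_trans V (adj G) x y.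
Proof.
elim=> {x y} [x y [Axy _ _]|x|x y z _ xy _ yz].
- exact: rt_step.
- exact: rt_refl.
- exact: rt_trans xy yz.
Qed.

Lemma acyclic_induced (V : Type) (G : graph V) (F : set V) :
  acyclic G -> acyclic (induced G F).
Proof.
move=> acG n c [n3 inj_c Ac]; apply: (acG n (val \o c)); split=> //.
by apply: inj_comp => //; exact: val_inj.
Qed.

(** * Cliques over a complete set and the star graph *)

Section Cliques.
Variables (V : Type) (G : graph V).
Implicit Types (K L M : cliques G) (C : set V).

Lemma clique_complete K : complete_set G (val K).
Proof. by have [] := set_valP K. Qed.

Lemma clique_maximal K L : val K `<=` val L -> L = K.
Proof.
move=> KL; apply: val_inj; have [_ max_K] := set_valP K.
by apply: max_K => //; exact: clique_complete.
Qed.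

Definition over C := [set K : cliques G | C `<=` val K].

(* The union of the components of [G - C] that [K] meets; as [K] is complete,
   there is exactly one unless [K] is contained in [C]. *)
Definition comp C K := [set y | exists x, [/\ val K x, ~ C x & linked G (~` C) x y]].

(** In a complete set any link can be made to start at [x] instead, at the cost of one edge avoiding
    [C]. *)
Lemma comp_meet C K L x : val K x -> val L x -> ~ C x -> comp C K = comp C L.
Proof.
suff sub M N : val M x -> val N x -> ~ C x -> comp C M `<=` comp C N.
  by move=> Kx Lx nCx; apply/seteqP; split; exact: sub.
move=> Mx Nx nCx y [z [Mz nCz zy]]; exists x; split=> //.
have [<-//|xz] := pselect (z = x).
apply: linked_trans zy; apply: rt_step; split=> //.
by apply: clique_complete Mx Mz _; exact: nesym.
Qed.

Lemma complete_setU1 C x :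
  complete_set G C -> (forall c, C c -> adj G c x) -> complete_set G (x |` C).
Proof.
move=> cC Cx y z [->|Cy] [->|Cz] yz //; last exact: cC.
- by apply: adj_sym; exact: Cx.
- exact: Cx.
Qed.

Hypothesis lfG : locally_finite G.

(** Any vertex enlarging [C] is a neighbour of a fixed [v] in [C]; there are finitely many, so
    greedy enlargement stops at a clique. *)
Lemma over_nonempty C : C !=set0 -> complete_set G C -> over C !=set0.
Proof.
case=> v; move: C; apply: (finite_superset_ind _ _ _ (lfG v)) => C IH Cv cC.
have [[x [nCx cCx]]|maxC] := pselect (exists x, ~ C x /\ complete_set G (x |` C)).
  have Avx : adj G v x.
    by apply: cCx; [right | left | move=> vx; apply: nCx; rewrite -vx].
  have [K CxK] := IH x Avx nCx (or_intror Cv) cCx.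
  by exists K; apply: subset_trans CxK => y Cy; right.
have clC : is_clique G C.
  split=> // B cB CB; apply/seteqP; split=> // x Bx; apply: contrapT => nCx.
  by apply: maxC; exists x; split=> // y z [->|/CB By] [->|/CB Bz]; exact: cB.
by exists (exist _ C (mem_set clC)).
Qed.

Variable pick : set (cliques G) -> cliques G.
Hypothesis pickP : forall A, A !=set0 -> A (pick A).

Definition root C := pick (over C).

(* Depends on [K] only through [comp C K]. *)
Definition rep C K := pick [set L | over C L /\ comp C L = comp C K].

(* For each [C], the edges with intersection [C] form a star joining [root C] to
   one representative of every other component class of the cliques over [C]. *)
Definition star K L :=
  [/\ K = root (val K `&` val L), L = rep (val K `&` val L) L &
      comp (val K `&` val L) K <> comp (val K `&` val L) L].

Definition star_adj K L := (val K `&` val L) !=set0 /\ (star K L \/ star L K).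

Lemma star_adj_sym K L : star_adj K L -> star_adj L K.
Proof. by case=> KL0 KL; split; [rewrite setIC | case: KL; [right | left]]. Qed.

Lemma star_adj_irrefl K : ~ star_adj K K.
Proof. by case=> _ [] [_ _]. Qed.

Definition star_graph : graph (cliques G) := Graph star_adj_sym star_adj_irrefl.

Lemma star_graph_sub K L : adj star_graph K L -> adj (clique_graph G) K L.
Proof. by move=> KL; split; [move=> eKL; rewrite eKL in KL; exact: adj_irrefl KL | case: KL]. Qed.

Lemma rep_comp C K L : comp C K = comp C L -> rep C K = rep C L.
Proof. by rewrite /rep => ->. Qed.

Lemma repP C K : over C K -> over C (rep C K) /\ comp C (rep C K) = comp C K.
Proof.
by move=> CK; apply: (pickP [set L | over C L /\ comp C L = comp C K]); exists K.
Qed.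

(* Each [C] is enlarged by one vertex at a time, so that the cliques along a walk
   in the common neighbourhood of [C] are linked by the induction hypothesis. *)
Lemma linked_over C K L : chordal G -> C !=set0 -> complete_set G C ->
  over C K -> over C L -> linked star_graph (over C) K L.
Proof.
move=> chG [v]; move: C K L.
apply: (finite_superset_ind _ _ _ (lfG v)) => C IH K L Cv cC.
have IHx x M N : (forall c, C c -> adj G c x) ->
    over (x |` C) M -> over (x |` C) N -> linked star_graph (over C) M N.
  move=> Cx xM xN; apply: (@linked_sub _ _ (over (x |` C))).
    by move=> O; apply: subset_trans => y Cy; right.
  apply: IH => //; first exact: Cx.
  - by move=> /Cx; exact: adj_irrefl.
  - by right.
  - exact: complete_setU1.
have same M N : over C M -> over C N -> comp C M = comp C N ->
    linked star_graph (over C) M N.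
  move=> CM CN eMN; have [[x [Mx nCx]]|MC] := pselect (exists x, val M x /\ ~ C x); last first.
    rewrite (clique_maximal M N); first exact: rt_refl.
    by move=> x Mx; apply: CN; apply: contrapT => nCx; apply: MC; exists x.
  have [y [Ny nCy yx]] : comp C N x by rewrite -eMN; exists x; split=> //; exact: rt_refl.
  have adjC O z : over C O -> val O z -> ~ C z -> forall c, C c -> adj G c z.
    move=> CO Oz nCz c Cc; apply: clique_complete (CO _ Cc) Oz _ => cz.
    by apply: nCz; rewrite -cz.
  have Cy := adjC N y CN Ny nCy; have Cx := adjC M x CM Mx nCx.
  have [m [p [[Ap Cp] p0 pm]]] :=
    linked_walk _ _ _ _ _ Cy (chordal_linked _ _ chG C y x Cy Cx yx).
  have over_U1 O z : over C O -> val O z -> over (z |` C) O.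
    by move=> CO Oz t [->|/CO].
  apply: linked_sym; suff NM i : (i <= m)%N -> forall O, over (p i |` C) O ->
      linked star_graph (over C) N O.
    by apply: (NM m) => //; apply: over_U1 => //; rewrite pm.
  elim: i => [_|i IHi im] O piO.
    by apply: (IHx (p 0)) => //; [rewrite p0 | apply: over_U1 => //; rewrite p0].
  (* [Q] contains [C] and both ends of a walk edge, so it links the cliques over [p i] to those over
     [p i.+1]. *)
  have [||Q CQ] := over_nonempty (p i.+1 |` (p i |` C)).
  - by exists v; right; right.
  - apply: complete_setU1 => [|c [->|Cc]].
    + by apply: complete_setU1 => // c Cc; apply: Cp => //; exact: ltnW.
    + exact: Ap.
    + exact: (Cp i.+1).
  apply: (@linked_trans _ _ _ _ Q).
    by apply: IHi; [exact: ltnW | move=> z Cz; apply: CQ; right].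
  apply: (IHx (p i.+1)) => //; first exact: (Cp i.+1).
  by move=> z [->|Cz]; apply: CQ; [left | right; right].
suff to_root M : over C M -> linked star_graph (over C) M (root C).
  by move=> /to_root Kr /to_root Lr; apply: linked_trans Kr _; exact: linked_sym.
move=> CM; have Cr : over C (root C) by apply: pickP; exists M.
have [eMr|nMr] := pselect (comp C M = comp C (root C)); first exact: same.
have [CR eRM] := repP _ _ CM; set R := rep C M in CR eRM.
apply: (@linked_trans _ _ _ _ R); first exact: same.
apply: linked_sym; apply: rt_step; split=> //.
(* A common vertex outside [C] would merge the two classes. *)
have capC : val (root C) `&` val R = C.
  apply/seteqP; split=> x; last by move=> Cx; split; [exact: Cr | exact: CR].
  move=> [rx Rx]; apply: contrapT => nCx; apply: nMr.
  by rewrite -eRM; exact: (comp_meet _ _ _ x).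
split; first by exists v; rewrite capC.
left; split; rewrite capC //; last by rewrite eRM; exact: nesym.
by rewrite (rep_comp _ _ M).
Qed.

(* On a cycle, let [C] be an inclusion-minimal intersection of consecutive
   cliques. An edge changes the component of [G - C] only if its intersection is
   [C], i.e. if it belongs to the star of [C]; so the component of a leaf [L] of
   that star can be left through a single edge. *)
Lemma star_graph_acyclic : acyclic star_graph.
Proof.
move=> n c [n3 inj_c Ac].
pose I i := val (c i) `&` val (c (ordS i)).
have i0 : 'I_n := Ordinal (leq_trans (isT : (0 < 3)%N) n3).
(* Minimizing this count gives inclusion-minimality: fewer [I k] lie below a strictly smaller
   [I j]. *)
have [i _ min_i] := arg_minnP (P := xpredT) (i0 := i0)
  (fun i => #|[pred j | `[< I j `<=` I i >]]|) isT.
have {min_i} minI j : I j `<=` I i -> I j = I i.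
  move=> ji; apply: contrapT => nji; have := min_i j isT.
  rewrite leqNgt => /negP; apply; apply: proper_card; apply/properP; split.
    by apply/fintype.subsetP => k; rewrite !inE => kj x /kj/ji.
  exists i; first by rewrite inE.
  by apply/negP; rewrite inE => ij; apply: nji; apply/seteqP.
set C := I i in minI.
have [R [L [[Rroot Lrep RL] cRL]]] : exists R L,
    [/\ R = root C, L = rep C L & comp C R <> comp C L] /\
    ((c i = R /\ c (ordS i) = L) \/ (c i = L /\ c (ordS i) = R)).
  have [_ [st|st]] := Ac i; [exists (c i), (c (ordS i)) | exists (c (ordS i)), (c i)].
    by split=> //; left.
  by split; [move: st; rewrite /star setIC | right].
(* Edge [i] has exactly one end in the class of [L], so invariance along all other edges is
   contradictory. *)
have [] : (comp C (c i) = comp C L <-> comp C (c (ordS i)) = comp C L); last first.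
  by case: cRL => -[-> ->]; [move=> _ /(_ erefl) | move=> /(_ erefl)].
apply: (cyclic_exit _ (fun j => comp C (c j) = comp C L)) => j ji.
have [jC|njC] := pselect (I j `<=` C); last first.
  have [x [xj xj'] nCx] : exists2 x, I j x & ~ C x.
    apply: contrapT => nx; apply: njC => x Ix; apply: contrapT => nCx.
    by apply: nx; exists x.
  by rewrite (comp_meet _ _ _ x xj xj').
have eIj := minI j jC.
(* Injectivity excludes a second passage in the same direction; a reversed one would force a cycle
   of length 2. *)
have no_edge : ~ ((c j = R /\ c (ordS j) = L) \/ (c j = L /\ c (ordS j) = R)).
  have no_flip : ~ (c j = c (ordS i) /\ c (ordS j) = c i).
    by case=> /inj_c -> /inj_c; exact: (iter_ordS_neq _ i 2).
  by case: cRL => -[<- <-] [[e1 e2]|[e1 e2]]; by [apply: no_flip | apply: ji; exact: inj_c].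
have leaf k : c k = rep C (c k) -> comp C (c k) = comp C L -> c k = L.
  move=> ek ekL; rewrite ek [RHS]Lrep; exact: rep_comp.
have [_ []] := Ac j; rewrite /star.
- rewrite -/(I j) eIj -Rroot => -[jR jrep _]; rewrite jR; split=> [/RL//|/leaf jL].
  by case: no_edge; left; split=> //; exact: jL.
- rewrite setIC -/(I j) eIj -Rroot => -[jR jrep _]; rewrite jR; split=> [/leaf jL|/RL//].
  by case: no_edge; right; split=> //; exact: jL.
Qed.

End Cliques.

Arguments over {V}.

Theorem theorem3p2 (V : Type) (G : graph V) :
  infinite_set [set: V] -> connected G -> locally_finite G -> chordal G ->
  exists T : graph (cliques G), clique_tree T.
Proof.
move=> _ [[v0 _] conG] lfG chG.
have complete1 v : complete_set G [set v] by move=> x y -> ->.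
have over1 v : over G [set v] !=set0.
  by apply: over_nonempty => //; exists v.
have [K0 _] := over1 v0.
have [|pick pickP] := exists_choice (cliques G); first by exists K0.
pose T := star_graph _ _ pick.
have link1 v (K L : cliques G) : val K v -> val L v -> linked T (over G [set v]) K L.
  by move=> Kv Lv; apply: linked_over => //; [exists v | move=> _ -> ..].
have acT : acyclic T by exact: star_graph_acyclic.
(* The empty set is not maximal, as some clique contains [v0]. *)
have cliqueN0 (K : cliques G) : val K !=set0.
  have [//|K0'] := pselect (val K !=set0).
  have [L vL] := over1 v0; exists v0.
  rewrite -(clique_maximal _ _ K L); first exact: vL.
  by move=> x Kx; case: K0'; exists x.
exists T; split.
  split; first exact: star_graph_sub.
  split=> //; split; first by exists K0.
  move=> K L; have [[x Kx] [y Ly]] := (cliqueN0 K, cliqueN0 L).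
  (* A path of [G] lifts to [T]: a clique containing both ends of an edge lies over each of them. *)
  elim: (conG x y) K L Kx Ly => {x} {y} [x y Axy|x|x y z _ xy _ yz] K L Kx Ly.
  - have [||M xyM] := over_nonempty _ _ lfG [set x; y].
    + by exists x; left.
    + move=> s t [->|->] [->|->] // _; exact: adj_sym.
    apply: (rt_trans _ _ _ M); apply: linked_connected; apply: link1; eassumption || apply: xyM.
    + by left.
    + by right.
  - by apply: linked_connected; exact: link1 Kx Ly.
  - have [M My] := over1 y.
    by apply: rt_trans (xy K M Kx _) (yz M L _ Ly); exact: My.
move=> v; split; last exact: acyclic_induced.
split; first by have [K Kv] := over1 v; exists (exist _ K (mem_set (Kv v erefl))).
move=> K L; apply: linked_induced.
have := link1 v _ _ (set_valP K) (set_valP L).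
by apply: linked_sub => M; apply.
Qed.
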